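(* Let $(g,G,\mathbf p)_W$ be a real local holomorphic deformation of a real marked map $g$, with transfer operator $\mathcal A$. Assume that $|Dg^{q_j-l_j}(c_{l_j,j})|>1$ for all $r<j\le\nu$. Assume furthermore that all the eigenvalues of $\mathcal A$ lie in the set $\{\rho\in\mathbb C:|\rho|\le1,\ \rho\neq1\}$. Then the positively oriented transversality condition holds: $$\frac{\det(D\mathcal R(\mathbf c_1))}{\prod_{j=1}^\nu Dg^{q_j-1}(c_{1,j})}>0.$$
   Context: **Marked map.** A marked map is a map $g:P_0\cup U\to\mathbb C$, where $P_0\subset\mathbb C$ is finite and $U\subset\mathbb C$ is open, together with a finite set $P\supset P_0$ such that $g(P)\subset P$, $P\setminus P_0\subset U$, $g|_U$ is holomorphic and $g'(x)\ne 0$ for $x\in P\setminus P_0$. Write $P_0=\{c_{0,1},\dots,c_{0,\nu}\}$ (distinct points), $c_{n,j}=g^n(c_{0,j})$, $\mathbf c_0=(c_{0,j})_j$, $\mathbf c_1=(c_{1,j})_j$. It is real if $P\subset\mathbb R$, $U$ is conjugation invariant and $g(\bar z)=\overline{g(z)}$ on $U$. **Local holomorphic deformation.** $(g,G,\mathbf p)_W$ consists of an open connected $W\subset\mathbb C^\nu$ containing $\mathbf c_1$, a holomorphic map $\mathbf p=(p_1,\dots,p_\nu):W\to\mathbb C^\nu$ with $\mathbf p(\mathbf c_1)=\mathbf c_0$, and a holomorphic map $G:W\times U\to\mathbb C$, $(w,z)\mapsto G_w(z)$, with $G_{\mathbf c_1}=g|_U$. It is real if $W$ is conjugation invariant, $G_{\overline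 w}(\overline z)=\overline{G_w(z)}$ and $p_j(\overline w)=\overline{p_j(w)}$. **Critical relations.** For each $j$ exactly one of the following holds: (a) there are $q_j>0$ and $\mu(j)\in\{1,\dots,\nu\}$ with $g^{q_j}(c_{0,j})=c_{0,\mu(j)}$ and $g^k(c_{0,j})\notin P_0$ for $1\le k<q_j$; (b) there are $1\le l_j<q_j$ with $g^{q_j}(c_{0,j})=g^{l_j}(c_{0,j})$ and $g^k(c_{0,j})\notin P_0$ for $1\le k\le q_j$. Fix such integers, and label so that (a) holds for $1\le j\le r$ and (b) for $r<j\le\nu$. Near $\mathbf c_1$ define $\mathcal R=(R_1,\dots,R_\nu)$ by $R_j(w)=G_w^{q_j-1}(w_j)-p_{\mu(j)}(w)$ for $1\le j\le r$ and $R_j(w)=G_w^{q_j-1}(w_j)-G_w^{l_j-1}(w_j)$ for $r<j\le\nu$. **Transfer operator.** A holomorphic motion $h_\lambda$ of $g(P)$ over $(\Lambda,0)$ is a family of injections $h_\lambda:g(P)\to\mathbb C$, $\lambda\in\Lambda$ (a domain containing $0$), holomorphic in $\lambda$ with $h_0=\mathrm{id}$. With $\mathbf c_1(\lambda)=(h_\lambda(c_{1,j}))_j$, its lift $\hat h_\lambda$ (for $\lambda$ near $0$) is the holomorphic motion of $g(P)$ with $\hat h_\lambda(c_{0,j})=p_j(\mathbf c_1(\lambda))$ for $c_{0,j}\in g(P)$ and $G_{\mathbf c_1(\lambda)}(\hat h_\lambda(x))=h_\lambda(g(x))$ for $x\in g(P)\setminus P_0$. $\mathcal A:\mathbb C^{\#g(P)}\to\mathbb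 C^{\#g(P)}$ is the linear map sending $\left\{\frac{d}{d\lambda}h_\lambda(x)|_{\lambda=0}\right\}_{x\in g(P)}$ to $\left\{\frac{d}{d\lambda}\hat h_\lambda(x)|_{\lambda=0}\right\}_{x\in g(P)}$. Explicitly, $(\mathcal Av)(c_{0,j})=\sum_k\frac{\partial p_j}{\partial w_k}(\mathbf c_1)v(c_{1,k})$ for $c_{0,j}\in g(P)$ and $(\mathcal Av)(x)=\frac1{g'(x)}\Big(v(g(x))-\sum_k\frac{\partial G_w(x)}{\partial w_k}\big|_{w=\mathbf c_1}v(c_{1,k})\Big)$ for $x\in g(P)\setminus P_0$. *)

(* Defs.v *)
From HB Require Import structures.
From mathcomp Require Import all_boot all_order all_algebra finmap.
From mathcomp Require Import complex.
From mathcomp Require Import all_classical all_reals all_analysis.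

Set Implicit Arguments.
Unset Strict Implicit.
Unset Printing Implicit Defensive.
Import Order.TTheory GRing.Theory Num.Theory.
Import numFieldNormedType.Exports.

Local Open Scope ring_scope.
Local Open Scope classical_set_scope.

(* The complex plane over R, packed as a numClosedFieldType so that the
   library's normed-module structures on fields apply to it.  The order is the
   partial order of R[i]: [0 < z] says that z is real and positive. *)
Definition Cplx (R : realType) : numClosedFieldType := R[i].

Definition holomorphic_on (R : realType) (V W : normedModType (Cplx R))
    (D : set V) (f : V -> W) : Prop :=
  forall x, D x -> differentiable f x.

Section Maps.
Context {R : realType}.
Local Notation C := (Cplx R).
Context {nu : nat}.

(* A map g : P_0 `|` U -> C is given by a total function, of which only the
   values on P_0 `|` U matter; c0 lists the distinct points of P_0. *)
Definition marked_pts (c0 : 'rV[C]_nu) : {fset C} :=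
  [fset c0 0 j | j in 'I_nu]%fset.

Record marked_map (g : C -> C) (c0 : 'rV[C]_nu) (U : set C) (P : {fset C}) :
    Prop := MarkedMap {
  mm_inj : injective (c0 0);
  mm_P0 : {subset marked_pts c0 <= P};
  mm_open : open U;
  mm_stable : forall x, x \in P -> g x \in P;
  mm_PU : forall x, x \in P -> x \notin marked_pts c0 -> U x;
  mm_holo : holomorphic_on U g;
  mm_deriv : forall x, x \in P -> x \notin marked_pts c0 -> g^`() x != 0 }.

Record real_marked_map (g : C -> C) (U : set C) (P : {fset C}) : Prop :=
    RealMarkedMap {
  rmm_P : forall x, x \in P -> x \is Num.real;
  rmm_U : forall z, U z -> U z^*;
  rmm_g : forall z, U z -> g z^* = (g z)^* }.

Definition crit_value (g : C -> C) (c0 : 'rV[C]_nu) : 'rV[C]_nu :=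
  map_mx g c0.

Record local_deformation (g : C -> C) (c0 : 'rV[C]_nu) (U : set C)
    (W : set 'rV[C]_nu) (G : 'rV[C]_nu -> C -> C)
    (p : 'rV[C]_nu -> 'rV[C]_nu) : Prop := LocalDeformation {
  ld_open : open W;
  ld_connected : connected W;
  ld_W : W (crit_value g c0);
  ld_p_holo : holomorphic_on W p;
  ld_p : p (crit_value g c0) = c0;
  ld_G_holo :
    holomorphic_on (W `*` U) (fun wz : 'rV[C]_nu * C => G wz.1 wz.2);
  ld_G : forall z, U z -> G (crit_value g c0) z = g z }.

Record real_deformation (U : set C) (W : set 'rV[C]_nu)
    (G : 'rV[C]_nu -> C -> C) (p : 'rV[C]_nu -> 'rV[C]_nu) : Prop :=
    RealDeformation {
  rd_W : forall w, W w -> W (map_mx Num.conj w);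
  rd_G : forall w z, W w -> U z -> G (map_mx Num.conj w) z^* = (G w z)^*;
  rd_p : forall w, W w -> p (map_mx Num.conj w) = map_mx Num.conj (p w) }.

(* The two kinds of critical relations.  They are mutually exclusive: the second
   one implies that the orbit of c_{0,j} never meets P_0 again. *)
Definition returns (g : C -> C) (c0 : 'rV[C]_nu) (q : nat) (m j : 'I_nu) :=
  [/\ (0 < q)%N, iter q g (c0 0 j) = c0 0 m &
      forall k, (0 < k < q)%N -> iter k g (c0 0 j) \notin marked_pts c0].

Definition eventually_periodic (g : C -> C) (c0 : 'rV[C]_nu) (q l : nat)
    (j : 'I_nu) :=
  [/\ (0 < l < q)%N, iter q g (c0 0 j) = iter l g (c0 0 j) &
      forall k, (0 < k <= q)%N -> iter k g (c0 0 j) \notin marked_pts c0].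

(* Indices start at 0, so [returns] holds for j < r and [eventually_periodic] for
   r <= j. The Jacobian matrix 'J of the library acts on row vectors on the
   right, i.e. is the transpose of the usual one; its determinant is the same. *)
Definition relation_map (G : 'rV[C]_nu -> C -> C) (p : 'rV[C]_nu -> 'rV[C]_nu)
    (r : nat) (q l : 'I_nu -> nat) (mu : 'I_nu -> 'I_nu)
    (w : 'rV[C]_nu) : 'rV[C]_nu :=
  \row_j (if (j < r)%N then iter (q j).-1 (G w) (w 0 j) - p w 0 (mu j)
          else iter (q j).-1 (G w) (w 0 j) - iter (l j).-1 (G w) (w 0 j)).

Definition partial (f : 'rV[C]_nu -> C) (k : 'I_nu) (w : 'rV[C]_nu) : C :=
  'D_(delta_mx 0 k) f w.

Definition image_pts (g : C -> C) (P : {fset C}) : {fset C} :=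
  [fset g x | x in P]%fset.

(* Value of v : C^Q at a point of the plane; the default 0 outside Q is never
   used below, where the points all lie in Q = g(P). *)
Definition eval_at (Q : {fset C}) (v : {ffun Q -> C}) (y : C) : C :=
  oapp v 0 (insub y).

Lemma eval_atE (Q : {fset C}) (v : {ffun Q -> C}) (x : Q) :
  eval_at v (val x) = v x.
Proof. by rewrite /eval_at valK. Qed.

Lemma eval_at_is_linear (Q : {fset C}) (y : C) (a : C) (u v : {ffun Q -> C}) :
  eval_at (a *: u + v) y = a * eval_at u y + eval_at v y.
Proof.
rewrite /eval_at; case: insubP => [x _ _|_] /=; first by rewrite !ffunE.
by rewrite mulr0 addr0.
Qed.

Definition transfer_fun (g : C -> C) (c0 : 'rV[C]_nu) (P : {fset C})
    (G : 'rV[C]_nu -> C -> C) (p : 'rV[C]_nu -> 'rV[C]_nu)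
    (v : {ffun image_pts g P -> C}) : {ffun image_pts g P -> C} :=
  let c1 := crit_value g c0 in
  [ffun x => if [pick j | c0 0 j == val x] is Some j then
     \sum_k partial (fun w => p w 0 j) k c1 * eval_at v (c1 0 k)
   else
     (g^`()%classic (val x))^-1 * (eval_at v (g (val x))
       - \sum_k partial (G^~ (val x)) k c1 * eval_at v (c1 0 k))].

Lemma transfer_fun_is_linear g c0 P G p :
  linear (@transfer_fun g c0 P G p).
Proof.
move=> a u v; apply/ffunP => x; rewrite !ffunE.
have sumE (F : 'I_nu -> C) : \sum_k F k * eval_at (a *: u + v)
      (crit_value g c0 0 k) =
    a * (\sum_k F k * eval_at u (crit_value g c0 0 k)) +
    \sum_k F k * eval_at v (crit_value g c0 0 k).
  rewrite mulr_sumr -big_split; apply: eq_bigr => k _ /=.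
  by rewrite eval_at_is_linear mulrDr mulrCA.
case: pickP => [j _|_]; rewrite sumE // eval_at_is_linear.
by rewrite -[RHS]/(a * _ + _) mulrCA -mulrDr opprD mulrBr addrACA.
Qed.

HB.instance Definition _ g c0 P G p :=
  GRing.isLinear.Build C _ _ _ (@transfer_fun g c0 P G p)
    (@transfer_fun_is_linear g c0 P G p).

Definition transfer_operator (g : C -> C) (c0 : 'rV[C]_nu) (P : {fset C})
    (G : 'rV[C]_nu -> C -> C) (p : 'rV[C]_nu -> 'rV[C]_nu) :
    'End({ffun image_pts g P -> C}) :=
  linfun (@transfer_fun g c0 P G p).
Arguments transfer_operator : clear implicits.

(* The explicit formula above does what characterizes the transfer operator: it
   sends the derivative at 0 of a holomorphic motion of g(P) to the derivative
   at 0 of its lift (transfer_operator_lift).  The set L is the parameter domain,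
   shrunk so that the lift is defined over it. *)
Record holomorphic_motion (Q : {fset C}) (L : set C) (h : C -> C -> C) :
    Prop := HolomorphicMotion {
  hm_open : open L;
  hm_connected : connected L;
  hm_0 : L 0;
  hm_inj : forall z, L z -> {in Q &, injective (h z)};
  hm_holo : forall x, x \in Q -> holomorphic_on L (h^~ x);
  hm_id : forall x, x \in Q -> h 0 x = x }.

Definition moved_crit_value (g : C -> C) (c0 : 'rV[C]_nu) (h : C -> C -> C)
    (z : C) : 'rV[C]_nu :=
  map_mx (h z) (crit_value g c0).

Record motion_lift (g : C -> C) (c0 : 'rV[C]_nu) (U : set C) (P : {fset C})
    (W : set 'rV[C]_nu) (G : 'rV[C]_nu -> C -> C)
    (p : 'rV[C]_nu -> 'rV[C]_nu) (L : set C) (h hh : C -> C -> C) : Prop :=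
    MotionLift {
  ml_motion : holomorphic_motion (image_pts g P) L hh;
  ml_W : forall z, L z -> W (moved_crit_value g c0 h z);
  ml_U : forall z x, L z -> x \in image_pts g P -> x \notin marked_pts c0 ->
    U (hh z x);
  ml_P0 : forall z j, L z -> c0 0 j \in image_pts g P ->
    hh z (c0 0 j) = p (moved_crit_value g c0 h z) 0 j;
  ml_lift : forall z x, L z -> x \in image_pts g P -> x \notin marked_pts c0 ->
    G (moved_crit_value g c0 h z) (hh z x) = h z (g x) }.

Definition velocity (Q : {fset C}) (h : C -> C -> C) : {ffun Q -> C} :=
  [ffun x => (h^~ (val x))^`()%classic 0].

Lemma transfer_operator_lift g c0 U P W G p L h hh :
  marked_map g c0 U P -> local_deformation g c0 U W G p ->
  holomorphic_motion (image_pts g P) L h ->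
  motion_lift g c0 U P W G p L h hh ->
  transfer_operator g c0 P G p (velocity (image_pts g P) h) =
  velocity (image_pts g P) hh.
Proof.
move=> mm ld hm ml; rewrite /transfer_operator lfunE /=.
set c1 := crit_value g c0; set Q := image_pts g P.
pose m := moved_crit_value g c0 h.
have gQ x : x \in P -> g x \in Q by move=> xP; apply/imfsetP; exists x.
have QP x : x \in Q -> x \in P.
  by move=> /imfsetP[y /= yP ->]; apply: mm_stable mm _ yP.
have c0P k : c0 0 k \in P.
  by apply: (mm_P0 mm); apply/imfsetP; exists k.
have c1Q k : c1 0 k \in Q by rewrite mxE; apply: gQ.
have velE y : y \in Q -> eval_at (velocity Q h) y = (h^~ y)^`()%classic 0.
  by move=> yQ; rewrite -[y]/(val [` yQ]%fset) eval_atE ffunE.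
have L0 := hm_0 hm.
have nL : \forall z \near (0 : C), L z.
  by apply: open_nbhs_nbhs; split => //; exact: hm_open hm.
have m0 : m 0 = c1.
  by apply/rowP => k; rewrite /m /moved_crit_value mxE (hm_id hm).
pose e k := fun z : C => h z (c1 0 k) *: (delta_mx 0 k : 'rV[C]_nu).
have mE : m = \sum_k e k.
  apply/funext => z; rewrite fct_sumE; apply/rowP => k.
  rewrite summxE (bigD1 k) //= big1 ?addr0 => [|i ik]; last first.
    by rewrite !mxE eqxx eq_sym (negbTE ik) mulr0.
  by rewrite !mxE !eqxx mulr1.
have dh k : differentiable (h^~ (c1 0 k)) 0 by apply: (hm_holo hm).
have de k : differentiable (e k) 0 by exact: differentiableZl.
have dm : differentiable m 0 by rewrite mE; exact: differentiable_sum.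
have dm1 : 'd m 0 1 = \sum_k eval_at (velocity Q h) (c1 0 k) *: delta_mx 0 k.
  rewrite -deriveE // mE derive_sum => [|k]; last exact: diff_derivable.
  apply: eq_bigr => k _; rewrite deriveE // diffZl //=.
  by rewrite velE // derive1E deriveE.
have dcomp (f : 'rV[C]_nu -> C) : differentiable f c1 ->
    'd f c1 ('d m 0 1) =
    \sum_k partial f k c1 * eval_at (velocity Q h) (c1 0 k).
  move=> df; rewrite dm1 linear_sum; apply: eq_bigr => k _ /=.
  by rewrite linearZ /= /partial deriveE // mulrC.
apply/ffunP => x; rewrite !ffunE.
have xQ : val x \in Q by exact: valP.
case: pickP => [j /eqP c0x|c0x].
  have dp : differentiable (fun w => p w 0 j) c1.
    apply: (differentiable_comp (g := fun v : 'rV[C]_nu => v 0 j)).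
      by apply: (ld_p_holo ld); exact: ld_W ld.
    exact: differentiable_coord.
  rewrite -dcomp // derive1E.
  rewrite (@near_eq_derive _ _ _ _ ((fun w => p w 0 j) \o m)); last first.
    near=> z; rewrite /= -c0x (ml_P0 ml) //; last by rewrite c0x.
    by near: z.
  have dp0 : differentiable (fun w => p w 0 j) (m 0) by rewrite m0.
  rewrite deriveE; last exact: differentiable_comp.
  by rewrite (diff_comp dm dp0) /= m0.
have xP0 : val x \notin marked_pts c0.
  by apply/imfsetP => -[j _ xj]; have := c0x j; rewrite xj eqxx.
have Ux : U (val x) by apply: (mm_PU mm) => //; exact: QP.
have gx0 : g^`()%classic (val x) != 0 by apply: (mm_deriv mm) => //; exact: QP.
have Wc1 : W c1 := ld_W ld.
pose F := (fun wz : 'rV[C]_nu * C => G wz.1 wz.2).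
have dF : differentiable F (c1, val x) by apply: (ld_G_holo ld).
have dhx : differentiable (hh^~ (val x)) 0.
  by apply: (hm_holo (ml_motion ml)).
set t := (hh^~ (val x))^`()%classic 0.
pose ga := (fun z : C => (m z, hh z (val x))).
have ga0 : ga 0 = (c1, val x) by rewrite /ga m0 (hm_id (ml_motion ml)).
have dga : differentiable ga 0 by exact: differentiable_pair.
have E : (h^~ (g (val x)))^`()%classic 0 = 'd F (c1, val x) ('d m 0 1, t).
  rewrite derive1E (@near_eq_derive _ _ _ _ (F \o ga)); last first.
    near=> z; rewrite /F /ga /= (ml_lift ml) //.
    by near: z.
  have dF0 : differentiable F (ga 0) by rewrite ga0.
  rewrite deriveE; last exact: differentiable_comp.
  rewrite (diff_comp dga dF0) /= ga0 diff_pair //=.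
  by rewrite -(deriveE _ dhx) -derive1E.
pose i1 := (fun w : 'rV[C]_nu => (w, val x)).
have di1 : differentiable i1 c1 by exact: differentiable_pair.
have dG1 : differentiable (G^~ (val x)) c1.
  by rewrite (_ : G^~ _ = F \o i1) //; exact: differentiable_comp.
have E1 u : 'd F (c1, val x) (u, 0) = 'd (G^~ (val x)) c1 u.
  rewrite (_ : G^~ _ = F \o i1) // diff_comp //= diff_pair //=.
  by rewrite diff_cst diff_val.
pose i2 := (fun z : C => (c1, z)).
have did : differentiable (id : C -> C) (val x).
  exact: (@ex_diff _ _ _ _ _ _ _ (is_diff_id _)).
have dc1 : differentiable (cst c1 : C -> 'rV[C]_nu) (val x).
  exact: differentiable_cst.
have di2 : differentiable i2 (val x) := differentiable_pair dc1 did.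
have E2 : 'd F (c1, val x) (0, t) = t * g^`()%classic (val x).
  have -> : g^`()%classic (val x) = 'd F (c1, val x) (0, 1).
    rewrite derive1E (@near_eq_derive _ _ _ _ (F \o i2)); last first.
      have nU : \forall z \near val x, U z.
        by apply: open_nbhs_nbhs; split => //; exact: mm_open mm.
      near=> z; rewrite /F /i2 /= (ld_G ld) //.
      by near: z.
    rewrite deriveE; last exact: (differentiable_comp di2 dF).
    by rewrite (diff_comp di2 dF) /= (diff_pair dc1 did) /= diff_cst diff_val.
  have -> : (0, t) = t *: ((0, 1) : 'rV[C]_nu * C).
    by congr pair; rewrite /= ?scaler0 // -[RHS]/(t * 1) mulr1.
  by rewrite linearZ.
have -> : eval_at (velocity Q h) (g (val x)) = 'd F (c1, val x) ('d m 0 1, t).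
  by rewrite velE ?E //; apply: gQ; exact: QP.
have -> : ('d m 0 1, t) = ('d m 0 1, 0) + (0, t) :> 'rV[C]_nu * C.
  by congr pair; rewrite /= ?addr0 ?add0r.
by rewrite linearD E1 E2 dcomp // addrAC subrr add0r mulrC mulfK.
Unshelve. all: by end_near. Qed.

End Maps.

Arguments transfer_operator {R nu} g c0 P G p.

(* Main.v *)
(* Scaling the relations along the orbits by powers of t gives a matrix D(t),
   polynomial in t with real coefficients, such that D(0) = I and det D(1) is
   the quotient in the statement.  If det D(t) = 0 for some t in (0, 1], a kernel
   vector w spreads along the critical orbits to a t^-1-eigenvector of the
   transfer operator: where two orbits meet, the two values agree because the
   orbits return to P_0 together or, if they never return, because the cycle
   they end in is expanding.  Since |t^-1| >= 1 this contradicts the spectral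
   assumption, so det D has no zero on [0, 1] and is positive at 1. *)

Require Import Defs.
From HB Require Import structures.
From mathcomp Require Import all_boot all_order all_algebra finmap.
From mathcomp Require Import complex.
From mathcomp Require Import all_classical all_reals all_analysis.
From mathcomp Require Import ring zify.

Set Implicit Arguments.
Unset Strict Implicit.
Unset Printing Implicit Defensive.
Import Order.TTheory GRing.Theory Num.Theory.
Import numFieldNormedType.Exports.

Local Open Scope ring_scope.
Local Open Scope classical_set_scope.

(** * Signs of real polynomials and eigenvalues on a quotient *)

(** Intermediate value theorem. Real coefficients let [f] descend to a polynomial [f'] over [R], and
    a value of [f'] at 1 that is not positive would force a root in (0, 1]. *)
Lemma real_poly_gt0 (R : realType) (f : {poly Cplx R}) :
  (forall i, f`_i \is Num.real) -> 0 < f.[0] ->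
  (forall t, 0 < t <= 1 -> ~~ root f t) -> 0 < f.[1].
Proof.
move=> freal f0 froot.
pose f' : {poly R} := \poly_(i < size f) complex.Re f`_i.
have fE : f = map_poly (real_complex R) f'.
  apply/polyP => i; rewrite coef_map coef_poly /=.
  case: ltnP => [_|le_fi]; first by rewrite RRe_real.
  by rewrite nth_default // raddf0.
have fx x : f.[(x%:C)%C] = (f'.[x]%:C)%C by rewrite fE horner_map.
have f'0 : 0 < f'.[0] by rewrite -ltcR -fx.
rewrite -[1 : Cplx R]/((1%:C)%C) fx ltcR ltNge; apply/negP => f'1.
have [x /andP[x0 x1] rx] : exists2 x, 0 <= x <= 1 & root (- f') x.
  by apply: poly_ivt; rewrite ?ler01 // !hornerN oppr_le0 oppr_ge0 f'1 ltW.
move: rx; rewrite rootN => /rootP rx.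
have x_gt0 : 0 < x.
  rewrite lt_neqAle x0 andbT; apply/eqP => x_eq0.
  by move: f'0; rewrite [X in f'.[X]]x_eq0 rx ltxx.
have /froot : 0 < ((x%:C)%C : Cplx R) <= 1.
  by rewrite -[0 : Cplx R]/((0%:C)%C) -[1 : Cplx R]/((1%:C)%C) ltcR lecR x_gt0.
by rewrite /root fx rx eqxx.
Qed.

(* Extending [v] from [S] to all of [T]: the functions vanishing on [S] form an
   [A]-invariant subspace, which [A - s] maps onto itself if it is injective. *)
Lemma leigenvalue_quotient (F : numClosedFieldType) (T : finType)
    (A : 'End({ffun T -> F})) (S : pred T) (s : F) (v : {ffun T -> F}) :
  (forall u : {ffun T -> F}, (forall x, S x -> u x = 0) ->
    forall x, S x -> A u x = 0) ->
  (forall x, S x -> A v x = s * v x) -> (exists2 x, S x & v x != 0) ->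
  passmx.leigenvalue A s.
Proof.
move=> AS Av [x0 Sx0 vx0]; apply/negP => kerB.
pose restr (u : {ffun T -> F}) := [ffun x => if S x then u x else 0].
have restr_lin : linear restr.
  move=> a u1 u2; apply/ffunP => x; rewrite !ffunE.
  by case: ifP => // _; rewrite scaler0 addr0.
pose restrL := GRing.isLinear.Build _ _ _ _ restr restr_lin.
pose rL : {linear {ffun T -> F} -> {ffun T -> F}} := HB.pack restr restrL.
pose K := lker (linfun rL).
have KP (u : {ffun T -> F}) : reflect (forall x, S x -> u x = 0) (u \in K).
  rewrite memv_ker lfunE /=; apply: (iffP eqP) => [/ffunP ru x Sx|u0].
    by have := ru x; rewrite !ffunE Sx.
  by apply/ffunP => x; rewrite !ffunE; case: ifP => // /u0.
pose B := (A - s *: \1)%VF.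
have kB0 : lker B = 0%VS by exact: (eqP kerB).
have BE (u : {ffun T -> F}) x : B u x = A u x - s * u x.
  have -> : B u = A u - s *: u.
    by rewrite add_lfunE opp_lfunE scale_lfunE id_lfunE.
  by rewrite !ffunE.
have BK : (B @: K)%VS = K.
  apply/eqP; rewrite eqEdim; apply/andP; split.
    apply/subvP => _ /memv_imgP[u /KP uK ->]; apply/KP => x Sx.
    by rewrite BE uK // mulr0 subr0 AS.
  by rewrite limg_dim_eq // kB0 capv0.
(* [B v] lies in [K], so it equals [B u] for some [u] in [K]. Injectivity of [B] then gives [v = u],
   although [v] does not vanish on [S]. *)
have : B v \in K by apply/KP => x Sx; rewrite BE Av // subrr.
rewrite -BK => /memv_imgP[u uK Bu].
have : v - u \in lker B by rewrite memv_ker linearB /= Bu subrr.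
rewrite kB0 memv0 subr_eq0 => /eqP vu.
by move: vx0; rewrite vu (KP _ uK) // eqxx.
Qed.

(** * Linear forms along the critical orbits *)

Section Variation.
Context {R : realType} {nu : nat}.
Local Notation C := (Cplx R).
(** [dg], [dG] and [dp] are arbitrary functions, so that this section is pure algebra. They become
    g' and the partial derivatives of G and p at c_1. *)
Context (g dg : C -> C) (dG : C -> 'I_nu -> C) (dp : 'I_nu -> 'I_nu -> C).
Context (c0 : 'rV[C]_nu).

(** By the chain rule this is Dg^n(x) when [dg] is g'; see [derive1_iter]. *)
Definition multiplier (x : C) (n : nat) : C := \prod_(i < n) dg (iter i g x).

Lemma multiplierS x n : multiplier x n.+1 = multiplier x n * dg (iter n g x).
Proof. by rewrite /multiplier big_ord_recr. Qed.

Lemma multiplierD x m n :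
  multiplier x (m + n) = multiplier x m * multiplier (iter m g x) n.
Proof.
elim: n => [|n IHn]; first by rewrite addn0 /multiplier big_ord0 mulr1.
by rewrite addnS !multiplierS IHn -mulrA addnC iterD.
Qed.

Lemma multiplierX x m n :
  iter m g x = x -> multiplier x (n * m) = multiplier x m ^+ n.
Proof.
move=> gx; elim: n => [|n IHn]; first by rewrite /multiplier big_ord0.
by rewrite mulSn multiplierD gx IHn exprS.
Qed.

(* For t = 1 this is the derivative of w |-> G_w^n(w_j) in the direction w; for
   other t, the value at c_{n+1,j} of a t^-1-eigenvector v of the transfer
   operator with v(c_{1,k}) = w_k. *)
Fixpoint variation (t : C) (w : 'rV[C]_nu) (j : 'I_nu) (n : nat) : C :=
  if n is m.+1 then
    t^-1 * dg (iter n g (c0 0 j)) * variation t w j m +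
      \sum_k dG (iter n g (c0 0 j)) k * w 0 k
  else w 0 j.

(* The coefficients of [variation t w j n] as a linear form in w, multiplied by
   t^n / Dg^n(c_{1,j}) so that they become polynomials in t. *)
Fixpoint scaled_variation (j k : 'I_nu) (n : nat) : {poly C} :=
  if n is m.+1 then
    scaled_variation j k m +
      (dG (iter n g (c0 0 j)) k / multiplier (g (c0 0 j)) n)%:P * 'X^n
  else (j == k)%:R.

(** Passing from n to n + 1 multiplies the prefactor by t / dg(c_{n+1,j}), which cancels the
    coefficient t^-1 dg(c_{n+1,j}) of the recursion. *)
Lemma scaled_variationE (t : C) (w : 'rV[C]_nu) j n :
  t != 0 -> multiplier (g (c0 0 j)) n != 0 ->
  \sum_k (scaled_variation j k n).[t] * w 0 k =
  t ^+ n / multiplier (g (c0 0 j)) n * variation t w j n.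
Proof.
move=> t0; elim: n => [_|n IHn] /=.
  rewrite /multiplier big_ord0 invr1 !mul1r (bigD1 j) //= eqxx hornerE mul1r.
  rewrite big1 ?addr0 // => k kj.
  by rewrite eq_sym (negbTE kj) hornerE mul0r.
move=> mn; have [m0 d0] : multiplier (g (c0 0 j)) n != 0 /\
    dg (iter n.+1 g (c0 0 j)) != 0.
  by move: mn; rewrite multiplierS mulf_eq0 negb_or -iterSr => /andP.
under eq_bigr do rewrite hornerD mulrDl.
rewrite big_split /= IHn // mulrDr; congr (_ + _); last first.
  by rewrite mulr_sumr; apply: eq_bigr => k _; rewrite !hornerE /=; ring.
rewrite multiplierS -iterSr /= exprS; field.
by move: d0 => /= ->; rewrite t0 m0.
Qed.

(** * The matrix D(t) of the scaled relations *)

Context (r : nat) (q l : 'I_nu -> nat) (mu : 'I_nu -> 'I_nu).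

(** This is D. Row j consists of the coefficients of [relation_variation t w j] in w, times t^(q_j -
    1) / Dg^(q_j - 1)(c_{1,j}). For r <= j this factor splits at c_{l_j,j}, which makes the second
    term a multiple of a [scaled_variation]. *)
Definition relation_poly : 'M[{poly C}]_nu := \matrix_(j, k)
  (scaled_variation j k (q j).-1 -
   if (j < r)%N then
     (dp (mu j) k / multiplier (g (c0 0 j)) (q j).-1)%:P * 'X^(q j)
   else (multiplier (iter (l j) g (c0 0 j)) (q j - l j))^-1%:P *
     'X^(q j - l j) * scaled_variation j k (l j).-1).

(** For t = 1 this is the derivative of R_j in the direction w. The factor t appears because a
    t^-1-eigenvector v satisfies v = t A v, hence v(c_{0,i}) = t * sum_k dp_i,k w_k. *)
Definition relation_variation (t : C) (w : 'rV[C]_nu) (j : 'I_nu) : C :=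
  variation t w j (q j).-1 -
  if (j < r)%N then t * \sum_k dp (mu j) k * w 0 k
  else variation t w j (l j).-1.

Context (c0_inj : injective (c0 0))
  (rel_a : forall j : 'I_nu, (j < r)%N -> returns g c0 (q j) (mu j) j)
  (rel_b : forall j : 'I_nu, (r <= j)%N ->
    eventually_periodic g c0 (q j) (l j) j)
  (dg_neq0 : forall j n, (0 < n)%N ->
    iter n g (c0 0 j) \notin marked_pts c0 -> dg (iter n g (c0 0 j)) != 0).

Lemma period_gt0 j : (0 < q j)%N.
Proof.
case: (ltnP j r) => [/rel_a[] // | /rel_b[/andP[l0 lq] _ _]].
exact: ltn_trans lq.
Qed.

Lemma first_return_notin j n :
  (0 < n < q j)%N -> iter n g (c0 0 j) \notin marked_pts c0.
Proof.
case: (ltnP j r) => [/rel_a[_ _]|/rel_b[_ _ H /andP[n0 nq]]]; first exact.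
by apply: H; rewrite n0 ltnW.
Qed.

Lemma multiplier_neq0 j n :
  (n < q j)%N -> multiplier (g (c0 0 j)) n != 0.
Proof.
move=> nq; rewrite prodf_seq_neq0; apply/allP => i _ /=.
rewrite -iterSr dg_neq0 // first_return_notin //=.
exact: leq_ltn_trans (ltn_ord i) nq.
Qed.

Lemma relation_polyE (t : C) (w : 'rV[C]_nu) j : t != 0 ->
  \sum_k (relation_poly j k).[t] * w 0 k =
  t ^+ (q j).-1 / multiplier (g (c0 0 j)) (q j).-1 *
    relation_variation t w j.
Proof.
move=> t0; have q0 := period_gt0 j.
have mq : multiplier (g (c0 0 j)) (q j).-1 != 0.
  by rewrite multiplier_neq0 ?prednK.
under eq_bigr do rewrite mxE hornerD hornerN mulrBl.
rewrite sumrB scaled_variationE // /relation_variation mulrBr; congr (_ - _).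
case: (ltnP j r) => jr.
  rewrite !mulr_sumr; apply: eq_bigr => k _; rewrite !hornerE /=.
  by rewrite -[in LHS](prednK q0) exprS /=; field.
have [/andP[l0 lq] _ _] := rel_b jr.
have ml : multiplier (g (c0 0 j)) (l j).-1 != 0.
  by rewrite multiplier_neq0 // prednK // ltnW.
under eq_bigr do rewrite !hornerE /= -[_ * w _ _]mulrA.
rewrite -mulr_sumr scaled_variationE //.
(* From c_{1,j}, the first l_j - 1 steps lead to c_{l_j,j}, where the remaining q_j - l_j steps
   begin. *)
have qE : (q j).-1 = ((l j).-1 + (q j - l j))%N by lia.
move: mq; rewrite qE multiplierD -iterSr prednK // mulf_eq0 negb_or.
case/andP=> _ mql; rewrite exprD; field.
by rewrite ml mql.
Qed.

(** Every term other than the initial [(j == k)%:R] carries a positive power of X: n + 1, q_j or q_j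
    - l_j. *)
Lemma relation_poly0 : map_mx (horner_eval 0) relation_poly = 1%:M.
Proof.
have sv0 j k n : (scaled_variation j k n).[0] = (j == k)%:R.
  elim: n => [|n IHn] /=; first by case: (j == k); rewrite hornerE.
  by rewrite !hornerE IHn expr0n /= mulr0 addr0.
apply/matrixP => j k; rewrite !mxE /horner_eval hornerD hornerN sv0.
have q0 := period_gt0 j; case: (ltnP j r) => jr.
  by rewrite !hornerE expr0n -[q j == 0%N]negbK -lt0n q0 mulr0 subr0.
have [/andP[_ lq] _ _] := rel_b jr.
by rewrite !hornerE expr0n subn_eq0 leqNgt lq mulr0 mul0r subr0.
Qed.

(** The entries are built from [dG], [dg] and [dp] by field operations. The lemma serves with [S]
    the real numbers. *)
Lemma det_relation_poly_closed (S : divringClosed C) :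
  (forall j n, (0 < n)%N -> iter n g (c0 0 j) \notin marked_pts c0 ->
    (forall k, dG (iter n g (c0 0 j)) k \in S) /\
    dg (iter n g (c0 0 j)) \in S) ->
  (forall j k, dp j k \in S) -> forall i, (\det relation_poly)`_i \in S.
Proof.
move=> orbS dpS; apply/polyOverP.
have multS j m n : (forall i, (i < n)%N ->
    (0 < i + m)%N /\ iter (i + m) g (c0 0 j) \notin marked_pts c0) ->
    multiplier (iter m g (c0 0 j)) n \in S.
  move=> orbn; apply: rpred_prod => i _; rewrite -iterD.
  by have [i0 /(orbS _ _ i0)[]] := orbn i (ltn_ord i).
have multS1 j n : (n < q j)%N -> multiplier (g (c0 0 j)) n \in S.
  move=> nq; apply: (multS j 1%N) => i i_n.
  by rewrite addn1 first_return_notin //; lia.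
have svS j k n : (n < q j)%N -> scaled_variation j k n \is a polyOver S.
  elim: n => [_|n IHn nq] /=; first exact: rpred_nat.
  rewrite rpredD ?IHn 1?ltnW // rpredM ?polyOverXn // polyOverC.
  rewrite rpredM ?rpredV ?multS1 //.
  by have [] := orbS j n.+1 isT (@first_return_notin j n.+1 nq).
have DS j k : relation_poly j k \is a polyOver S.
  have q0 := period_gt0 j.
  rewrite mxE rpredB ?svS ?prednK //; case: ltnP => jr.
    by rewrite rpredM ?polyOverXn // polyOverC rpredM ?rpredV ?multS1 ?prednK.
  have [/andP[l0 lq] _ notin_b] := rel_b jr.
  apply: rpredM; last by rewrite svS // prednK // ltnW.
  rewrite rpredM ?polyOverXn // polyOverC rpredV multS //.
  by move=> i iq; split; [|apply: notin_b]; lia.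
rewrite /determinant rpred_sum // => s _.
by rewrite rpredM ?rpredX ?rpredN1 // rpred_prod.
Qed.

(** * From a kernel vector of D(t) to an eigenfunction on the critical orbits *)

Section Eigenvector.
Context (t : C) (w : 'rV[C]_nu) (t01 : 0 < t <= 1)
  (rel0 : forall j, relation_variation t w j = 0).
Context (expanding : forall j : 'I_nu, (r <= j)%N ->
  1 < `|multiplier (iter (l j) g (c0 0 j)) (q j - l j)|).

Let v := variation t w.
(** The shift by one makes [v j n] the value attached to the point [orb j n]. *)
Let orb (j : 'I_nu) n := iter n.+1 g (c0 0 j).
(* The indices n for which c_{n+1,j} lies on the orbit, stopped on its return to
   P_0. *)
Let running (j : 'I_nu) n := (j < r)%N ==> (n < q j)%N.

Let t_neq0 : t != 0. Proof. by case/andP: t01 => /gt_eqF ->. Qed.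

Let rel0_a (j : 'I_nu) :
  (j < r)%N -> v j (q j).-1 = t * \sum_k dp (mu j) k * w 0 k.
Proof.
by move=> jr; have := rel0 j; rewrite /relation_variation jr => /subr0_eq.
Qed.

Let rel0_b (j : 'I_nu) : (r <= j)%N -> v j (q j).-1 = v j (l j).-1.
Proof.
move=> jr; have := rel0 j.
by rewrite /relation_variation ltnNge jr => /subr0_eq.
Qed.

Let vS (j : 'I_nu) n : v j n.+1 =
  t^-1 * dg (orb j n) * v j n + \sum_k dG (orb j n) k * w 0 k.
Proof. by []. Qed.

Let orb_eqS (i j : 'I_nu) m n : orb i m = orb j n -> orb i m.+1 = orb j n.+1.
Proof. by rewrite /orb => e; rewrite iterS e. Qed.

Let orb_eqD (i j : 'I_nu) m n d :
  orb i m = orb j n -> orb i (m + d) = orb j (n + d).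
Proof.
by move=> e; elim: d => [|d]; rewrite ?addn0 // !addnS; exact: orb_eqS.
Qed.

Let orb_periodic (j : 'I_nu) d n : (r <= j)%N -> ((l j).-1 <= n)%N ->
  orb j (n + d * (q j - l j)) = orb j n.
Proof.
move=> /rel_b[/andP[l0 lq] gql _] ln.
elim: d => [|d IHd]; first by rewrite addn0.
rewrite -IHd mulSn addnCA addnC /orb.
have -> : (n + d * (q j - l j) + (q j - l j)).+1 =
  ((n.+1 - l j + d * (q j - l j)) + q j)%N by lia.
rewrite iterD gql -iterD; congr iter; lia.
Qed.

(** The relation for j gives the equality at n = l_j - 1. The recursion carries it on, since its
    coefficients depend only on the point of the orbit. *)
Let v_periodic1 (j : 'I_nu) n : (r <= j)%N -> ((l j).-1 <= n)%N ->
  v j (n + (q j - l j)) = v j n.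
Proof.
move=> jr; have [/andP[l0 lq] _ _] := rel_b jr.
elim: n => [|n IHn].
  rewrite leqn0 => /eqP l1; rewrite -[in RHS]l1 -rel0_b //; congr v; lia.
rewrite leq_eqVlt => /predU1P[lE|ln].
  rewrite -lE -rel0_b //; congr v; lia.
by rewrite addSn !vS IHn //; have := orb_periodic 1 jr ln; rewrite mul1n => ->.
Qed.

Let v_periodic (j : 'I_nu) d n : (r <= j)%N -> ((l j).-1 <= n)%N ->
  v j (n + d * (q j - l j)) = v j n.
Proof.
move=> jr ln; elim: d => [|d IHd]; first by rewrite addn0.
by rewrite mulSn addnCA addnC v_periodic1 // (leq_trans ln) // leq_addr.
Qed.

(** The critical relation excludes P_0 only up to time q_j; later indices are reduced modulo the
    period. *)
Let orb_notin (j : 'I_nu) n : (r <= j)%N -> orb j n \notin marked_pts c0.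
Proof.
move=> jr; have [/andP[l0 lq] _ H] := rel_b jr.
case: (ltnP n (q j)) => nq; first by apply: H; rewrite /= nq.
pose d := ((n - (l j).-1) %/ (q j - l j))%N.
pose e := ((n - (l j).-1) %% (q j - l j))%N.
have nE : n = ((l j).-1 + e + d * (q j - l j))%N.
  by rewrite -addnA [(e + _)%N]addnC -divn_eq subnKC //; lia.
have eq : (e < q j - l j)%N by rewrite ltn_mod subn_gt0.
rewrite nE orb_periodic ?leq_addr //; apply: H; rewrite /=; lia.
Qed.

Let runningS (j : 'I_nu) n :
  running j n -> orb j n \notin marked_pts c0 -> running j n.+1.
Proof.
rewrite /running; case: ltnP => //= jr nq xP0; rewrite ltn_neqAle nq andbT.
apply: contra xP0 => /eqP; rewrite /orb => ->.
by have [_ -> _] := rel_a jr; apply/imfsetP; exists (mu j).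
Qed.

(** The inhomogeneous terms [dG] depend only on the common point, so they cancel in the
    difference. *)
Let v_diffD (i j : 'I_nu) m n d :
  orb i m = orb j n -> v i (m + d) - v j (n + d) =
  t^-1 ^+ d * multiplier (orb i m) d * (v i m - v j n).
Proof.
move=> e; elim: d => [|d IHd].
  by rewrite !addn0 /multiplier big_ord0 expr0 !mul1r.
rewrite !addnS !vS (orb_eqD d e) opprD addrACA subrr addr0 -mulrBr IHd.
rewrite multiplierS -(orb_eqD d e) /orb -iterD addnS addnC exprS; ring.
Qed.

(** Equality propagates backwards because the factor t^-1 dg is nonzero off P_0. *)
Let v_diffS (i j : 'I_nu) m n : orb i m \notin marked_pts c0 ->
  orb i m = orb j n -> v i m.+1 = v j n.+1 -> v i m = v j n.
Proof.
move=> xP0 e /eqP; rewrite -subr_eq0 -(addn1 m) -(addn1 n) v_diffD //.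
rewrite /multiplier big_ord1 expr1 /= !mulf_eq0 invr_eq0 (negbTE t_neq0) /=.
by rewrite (negbTE (dg_neq0 _ _)) //= subr_eq0 => /eqP.
Qed.

Let running_end (j : 'I_nu) n : running j n -> orb j n \in marked_pts c0 ->
  (j < r)%N /\ n = (q j).-1.
Proof.
move=> jn xP0; have jr : (j < r)%N.
  by rewrite ltnNge; apply: contraL xP0; exact: orb_notin.
split=> //; move: jn; rewrite /running jr /= leq_eqVlt.
case/predU1P => [<- //|nq].
by move: xP0; rewrite (negbTE (first_return_notin _)).
Qed.

(** Both orbits are followed forward until they return to P_0. They do so at the same point, where
    [rel0_a] prescribes the same value for both, and [v_diffS] brings the equality back. The
    induction is on the time left before the return. *)
Let v_consistent_a (i j : 'I_nu) m n :
  (i < r)%N -> running i m -> running j n -> orb i m = orb j n -> v i m = v j n.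
Proof.
move=> ir; rewrite {1}/running ir /=.
have [k] := ubnP (q i - m); elim: k m n => // k IHk m n qm mq jn e.
have [xP0|xP0] := boolP (orb i m \in marked_pts c0); last first.
  apply: v_diffS => //; apply: IHk; try lia.
  - by have := runningS _ xP0; rewrite /running ir; apply.
  - by apply: runningS => //; rewrite -e.
  - exact: orb_eqS.
have [_ mE] : (i < r)%N /\ m = (q i).-1.
  by apply: running_end => //; rewrite /running mq implybT.
have [jr nE] : (j < r)%N /\ n = (q j).-1 by apply: running_end; rewrite -?e.
rewrite mE nE !rel0_a //.
have -> // : mu i = mu j.
have [_ gi _] := rel_a ir; have [_ gj _] := rel_a jr.
apply: c0_inj; rewrite -gi -gj.
by move: e; rewrite /orb mE nE !prednK // period_gt0.
Qed.

Let v_consistent_b (i j : 'I_nu) m n : (r <= i)%N -> (r <= j)%N ->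
  orb i m = orb j n -> v i m = v j n.
Proof.
(* Going b * a steps, a common multiple of both periods, around the cycle leaves
   the difference of the two values unchanged, but also multiplies it by a
   factor of modulus > 1. *)
move=> ir jr e.
have [/andP[li0 liq] _ _] := rel_b ir; have [/andP[lj0 ljq] _ _] := rel_b jr.
set a := (q i - l i)%N; set b := (q j - l j)%N.
have a0 : (0 < a)%N by rewrite subn_gt0.
(* Whole periods are added to l_i - 1, so that [orb i s] is c_{l_i,i}, the base point of the
   expansion hypothesis. Their number makes s at least m and puts the matching index n + d past
   l_j. *)
pose s := ((l i).-1 + (m + n + l j) * a)%N.
have ms : (m + n + l j <= s)%N by rewrite /s; nia.
have orb_s : orb i s = iter (l i) g (c0 0 i).
  by rewrite orb_periodic // /orb prednK.
pose d := (s - m)%N; have md : (m + d = s)%N by rewrite subnKC //; lia.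
have fix_s : v i s = v j (n + d).
  apply/eqP; rewrite -subr_eq0; apply/eqP; set dv := (X in X = 0).
  have dvE : dv = t^-1 ^+ (b * a) * multiplier (orb i s) (b * a) * dv.
    rewrite {2}/dv -v_diffD; last by rewrite -md; exact: orb_eqD.
    have -> : v i (s + b * a) = v i s.
      by apply: v_periodic => //; rewrite /s leq_addr.
    rewrite [(b * a)%N]mulnC.
    have -> // : v j (n + d + a * b) = v j (n + d).
    by apply: v_periodic => //; rewrite /d; lia.
  apply/eqP/negPn/negP => dv0.
  have : 1 < `|t^-1 ^+ (b * a) * multiplier (orb i s) (b * a)|.
    have cycle : iter a g (orb i s) = orb i s.
      have := @orb_periodic i 1 s ir (leq_addr _ _).
      by rewrite mul1n {1}/orb -addSn addnC iterD.
    have tV : 1 <= `|t^-1 ^+ a|.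
      case/andP: t01 => t0 t1; rewrite normrX; apply: exprn_ege1.
      by rewrite gtr0_norm ?invr_gt0 // invf_ge1.
    rewrite multiplierX // mulnC exprM -exprMn normrX.
    rewrite exprn_egt1 -?lt0n ?subn_gt0 //.
    rewrite normrM orb_s -[1]mulr1 (le_lt_trans (ler_wpM2r ler01 tV)) //.
    by rewrite ltr_pM2l ?expanding // (lt_le_trans ltr01).
  rewrite (_ : _ * _ = 1) ?normr1 ?ltxx //.
  by apply: (mulIf dv0); rewrite -dvE mul1r.
(* The values agree d steps later, and the factor acquired on the way is nonzero. *)
have /eqP := v_diffD d e; rewrite md fix_s subrr eq_sym !mulf_eq0.
have mult0 : multiplier (orb i m) d != 0.
  rewrite prodf_seq_neq0; apply/allP => k _ /=.
  rewrite /orb -iterD addnS dg_neq0 // -/(orb i _).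
  exact: orb_notin.
rewrite expf_eq0 invr_eq0 (negbTE t_neq0) andbF (negbTE mult0) subr_eq0.
by move/eqP.
Qed.

(** [V x] is read off a chosen index pair that reaches [x]; the consistency lemmas make it
    independent of the choice. The last two clauses are the eigenvalue equation for t^-1, solved for
    V(c_{0,i}) and for V(g(x)). The default 0 is taken only outside [S]. *)
Lemma orbit_eigenfunction : exists (S : pred C) (V : C -> C),
  [/\ forall k, S (g (c0 0 k)) /\ V (g (c0 0 k)) = w 0 k,
      forall x, S x -> exists j n, x = iter n.+1 g (c0 0 j),
      forall i, S (c0 0 i) -> V (c0 0 i) = t * \sum_k dp i k * w 0 k &
      forall x, S x -> x \notin marked_pts c0 -> S (g x) /\
        V (g x) = t^-1 * dg x * V x + \sum_k dG x k * w 0 k].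
Proof.
pose Sx x := exists jn : 'I_nu * nat, running jn.1 jn.2 /\ x = orb jn.1 jn.2.
pose V x := if pselect (Sx x) is left e
  then let jn := projT1 (cid e) in v jn.1 jn.2 else 0.
have VE j n : running j n -> V (orb j n) = v j n.
  move=> jn; rewrite /V; case: pselect => [e|[]]; last by exists (j, n).
  case: (cid e) => -[i m] /= [im e'].
  (* If only j < r, the first case applies with the roles of i and j exchanged. *)
  case: (ltnP i r) => ir; first exact: v_consistent_a.
  case: (ltnP j r) => jr; last exact: v_consistent_b.
  by apply/esym; apply: v_consistent_a.
exists (fun x => `[< Sx x >]), V; split.
- move=> k; have k0 : running k 0 by rewrite /running period_gt0 implybT.
  by split; [apply/asboolP; exists (k, 0%N) | exact: VE k0].
- by move=> x /asboolP[[j n] [_ ->]]; exists j, n.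
- move=> i /asboolP[[j n] /= [jn e]].
  have iP0 : orb j n \in marked_pts c0 by rewrite -e; apply/imfsetP; exists i.
  have [jr nE] := running_end jn iP0.
  rewrite e VE // nE rel0_a //; have -> // : mu j = i.
  apply: c0_inj; have [_ <- _] := rel_a jr.
  by rewrite e /orb nE prednK // period_gt0.
- move=> x /asboolP[[j n] /= [jn ->]] xP0; have jn1 := runningS jn xP0.
  split; first by apply/asboolP; exists (j, n.+1).
  by rewrite -[g _]/(orb j n.+1) !VE.
Qed.

End Eigenvector.
End Variation.

(** * Eigenfunctions on the orbits give eigenvalues of the transfer operator *)

(** [S] may be smaller than g(P). It contains every c_{1,k}, and g(x) for each of its points x off
    P_0, so the values of A u on [S] depend only on those of u on [S], and [leigenvalue_quotient]
    applies. *)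
Lemma leigenvalue_transfer_operator (R : realType) (nu : nat)
    (g : Cplx R -> Cplx R) (c0 : 'rV[Cplx R]_nu) (U : set (Cplx R))
    (P : {fset Cplx R}) (G : 'rV[Cplx R]_nu -> Cplx R -> Cplx R)
    (p : 'rV[Cplx R]_nu -> 'rV[Cplx R]_nu) (s : Cplx R)
    (S : pred (Cplx R)) (V : Cplx R -> Cplx R) :
  let c1 := crit_value g c0 in
  marked_map g c0 U P -> s != 0 ->
  (forall k, S (c1 0 k)) -> (exists k, V (c1 0 k) != 0) ->
  (forall x, S x -> x \in image_pts g P) ->
  (forall i, S (c0 0 i) ->
    \sum_k partial (fun w => p w 0 i) k c1 * V (c1 0 k) = s * V (c0 0 i)) ->
  (forall x, S x -> x \notin marked_pts c0 -> S (g x) /\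
    V (g x) = s * g^`()%classic x * V x +
      \sum_k partial (G^~ x) k c1 * V (c1 0 k)) ->
  passmx.leigenvalue (transfer_operator g c0 P G p) s.
Proof.
move=> c1 mm s0 Sc1 [k0 Vk0] SQ SP0 SPn; set Q := image_pts g P.
pose v : {ffun Q -> Cplx R} := [ffun x => V (val x)].
have evalE (u : {ffun Q -> Cplx R}) y (yQ : y \in Q) :
    eval_at u y = u [` yQ]%fset.
  by rewrite -[y in LHS]/(val [` yQ]%fset) eval_atE.
have vE y : S y -> eval_at v y = V y.
  by move=> Sy; rewrite (evalE _ _ (SQ _ Sy)) ffunE.
have notinP0 (x : Q) : (fun j => c0 0 j == val x) =1 xpred0 ->
    val x \notin marked_pts c0.
  by move=> c0x; apply/imfsetP => -[j _ xj]; have := c0x j; rewrite xj eqxx.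
apply: (@leigenvalue_quotient _ _ _ (fun x : Q => S (val x)) s v).
- move=> u u0 x Sx; have u0' y : S y -> eval_at u y = 0.
    by move=> Sy; rewrite (evalE _ _ (SQ _ Sy)) u0.
  rewrite lfunE ffunE; case: pickP => [j _|/notinP0 /SPn[//|Sgx _]].
    by rewrite big1 // => k _; rewrite u0' ?mulr0.
  by rewrite u0' // big1 ?subrr ?mulr0 // => k _; rewrite u0' ?mulr0.
- move=> x Sx; rewrite lfunE !ffunE; case: pickP => [j /eqP jx|].
    rewrite -jx -SP0 ?jx //; by apply: eq_bigr => k _; rewrite -/c1 vE.
  move=> /notinP0 xP0; have [Sgx Vgx] := SPn _ Sx xP0.
  have gx0 : g^`()%classic (val x) != 0.
    apply: (mm_deriv mm) => //; have /imfsetP[y /= yP ->] := SQ _ Sx.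
    exact: mm_stable mm _ yP.
  rewrite vE // Vgx; under [X in _ - X]eq_bigr do rewrite vE //.
  by rewrite addrK mulrA [s * _]mulrC mulKf.
- have kQ := SQ _ (Sc1 k0).
  by exists [` kQ]%fset; [exact: Sc1 | rewrite ffunE].
Qed.

(** * Derivatives and the Jacobian of the relations *)

(* The derivative is the limit of real difference quotients along real h. *)
Lemma derive_real (C : numClosedFieldType) (V : normedModType C) (f : V -> C)
    (a v : V) : derivable f a v ->
  (\forall h \near (0 : C), (h : C) \is Num.real ->
    f (h *: v + a) \is Num.real) ->
  'D_v f a \is Num.real.
Proof.
move=> df freal; set L := 'D_v f a; rewrite CrealE; apply/negPn/negP => LJ.
(* A real difference quotient is equally far from L and from its conjugate, so it cannot be within
   half their distance of L. *)
have e0 : 0 < `|L^* - L| / 2 by rewrite divr_gt0 // normr_gt0 subr_eq0.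
have fa : f a \is Num.real.
  by have := nbhs_singleton freal; rewrite scale0r add0r; apply; exact: rpred0.
have dnear : \forall h \near (0 : C)^',
      `|L - h^-1 *: (f (h *: v + a) - f a)| < `|L^* - L| / 2.
  by move/cvgrPdist_lt: df; apply.
have : \forall h \near (0 : C)^', (h : C) \is Num.real -> False.
  have freal' := nbhs_dnbhs freal.
  near=> h => hreal.
  have LD : `|L - h^-1 *: (f (h *: v + a) - f a)| < `|L^* - L| / 2 by near: h.
  have freal_h : h \is Num.real -> f (h *: v + a) \is Num.real by near: h.
  move: LD; set D := h^-1 *: _ => LD.
  have Dreal : D^* = D.
    by apply: conj_Creal; rewrite rpredM ?rpredV // rpredB // freal_h.
  have : `|L^* - L| < `|L^* - L|.
    rewrite [ltRHS]splitr (le_lt_trans (ler_distD D _ _)) // ltrD //.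
    by rewrite -Dreal -rmorphB norm_conjC.
    by rewrite distrC.
  by rewrite ltxx.
(* Every punctured ball around 0 contains a nonzero real number, here e / 2. *)
rewrite /dnbhs => /nbhs_ballP[e /= e1 ball_e].
apply: (ball_e (e / 2)); rewrite /= ?ball_normE.
- rewrite /ball /= sub0r normrN gtr0_norm ?divr_gt0 //.
  by rewrite ltr_pdivrMr // ltr_pMr // ltr1n.
- by rewrite mulf_neq0 ?invr_eq0 ?gt_eqF.
- by rewrite gtr0_real // divr_gt0.
Unshelve. all: by end_near. Qed.

Lemma diff_coord (C : numFieldType) (m n : nat) (M v : 'M[C]_(m, n)) i j :
  'd (fun N : 'M[C]_(m, n) => N i j : C) M v = v i j.
Proof.
pose coord (N : 'M[C]_(m, n)) : C := N i j.
have coord_lin : linear coord by move=> a u w; rewrite /coord !mxE.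
pose f : {linear 'M[C]_(m, n) -> C} :=
  HB.pack coord (GRing.isLinear.Build C _ _ _ coord coord_lin).
rewrite -[fun N => _]/(GRing.Linear.sort f) diff_lin //.
exact: coord_continuous.
Qed.

Lemma linear_mul (C : numFieldType) (f : {linear C -> C}) (s : C) :
  f s = f 1 * s.
Proof.
have -> : s = s *: (1 : C) by rewrite -[RHS]/(s * 1) mulr1.
by rewrite linearZ -[s *: (1 : C)]/(s * 1) mulr1 mulrC.
Qed.

Lemma derive1_comp_num (C : numFieldType) (f h : C -> C) (x : C) :
  differentiable f x -> differentiable h (f x) ->
  (h \o f)^`()%classic x = h^`()%classic (f x) * f^`()%classic x.
Proof.
move=> df dh; have dhf := differentiable_comp df dh.
have DE (k : C -> C) y : differentiable k y -> k^`()%classic y = 'd k y (1 : C).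
  by move=> dk; rewrite derive1E (deriveE _ dk).
rewrite (DE _ _ dhf) (DE _ _ df) (DE _ _ dh).
transitivity ('d h (f x) ('d f x (1 : C))); last exact: linear_mul.
exact: (congr1 (fun k : C -> C => k 1) (diff_comp df dh)).
Qed.

Lemma derive1_iter (R : realType) (g : Cplx R -> Cplx R) (U : set (Cplx R))
    (x : Cplx R) (n : nat) :
  holomorphic_on U g -> (forall i, (i < n)%N -> U (iter i g x)) ->
  differentiable (iter n g) x /\
  (iter n g)^`()%classic x = multiplier g g^`()%classic x n.
Proof.
move=> holg; elim: n => [_|n IHn Ux].
  split; first exact: (@ex_diff _ _ _ _ _ _ _ (is_diff_id _)).
  by rewrite /multiplier big_ord0 derive1E (derive_id x 1).
have [dn Dn] : differentiable (iter n g) x /\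
    (iter n g)^`()%classic x = multiplier g g^`()%classic x n.
  by apply: IHn => i /ltnW /Ux.
have dg : differentiable g (iter n g x) by apply: holg; exact: Ux.
split; first exact: (differentiable_comp dn dg).
transitivity ((g \o iter n g)^`()%classic x) => //.
by rewrite (derive1_comp_num dn dg) Dn multiplierS mulrC.
Qed.

(** * The Jacobian of the relations at c_1 *)

Section Deformation.
Context {R : realType} {nu : nat}.
Local Notation C := (Cplx R).
Context (g : C -> C) (c0 : 'rV[C]_nu) (U : set C) (P : {fset C}).
Context (W : set 'rV[C]_nu) (G : 'rV[C]_nu -> C -> C).
Context (p : 'rV[C]_nu -> 'rV[C]_nu).
Context (mm : marked_map g c0 U P) (ld : local_deformation g c0 U W G p).

Let c1 := crit_value g c0.
Let F (wz : 'rV[C]_nu * C) : C := G wz.1 wz.2.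
Let dF z : U z -> differentiable F (c1, z).
Proof. by move=> Uz; apply: (ld_G_holo ld); split=> //=; exact: ld_W ld. Qed.

Lemma linear_row (f : {linear 'rV[C]_nu -> C}) (u : 'rV[C]_nu) :
  f u = \sum_k f (delta_mx 0 k) * u 0 k.
Proof.
rewrite [u in LHS]row_sum_delta linear_sum; apply: eq_bigr => k _.
by rewrite linearZ /= mulrC.
Qed.

Lemma differentiable_slice z : U z -> differentiable (G^~ z) c1.
Proof.
move=> Uz; have di : differentiable (fun w : 'rV[C]_nu => (w, z)) c1.
  exact: differentiable_pair.
exact: (differentiable_comp di (dF Uz)).
Qed.

(** The differential splits into its two partial ones. In the z direction it is g', as G_{c_1} = g
    on the open set U. *)
Lemma diff_deformation z u s : U z ->
  'd F (c1, z) (u, s) =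
  g^`()%classic z * s + \sum_k partial (G^~ z) k c1 * u 0 k.
Proof.
move=> Uz; have -> : (u, s) = (u, 0) + s *: ((0, 1) : 'rV[C]_nu * C).
  by congr pair; rewrite /= ?scaler0 ?addr0 // add0r -[RHS]/(s * 1) mulr1.
rewrite linearD linearZ /= addrC; congr (_ + _).
  rewrite -[LHS]/(s * _) mulrC; congr (_ * _).
  pose i2 := (fun z : C => (c1, z)).
  have did : differentiable (id : C -> C) z.
    exact: (@ex_diff _ _ _ _ _ _ _ (is_diff_id _)).
  have dc1 : differentiable (cst c1 : C -> 'rV[C]_nu) z.
    exact: differentiable_cst.
  have di2 : differentiable i2 z := differentiable_pair dc1 did.
  rewrite derive1E (@near_eq_derive _ _ _ _ (F \o i2)); last first.
    have nU : \forall x \near z, U x.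
      by apply: open_nbhs_nbhs; split => //; exact: mm_open mm.
    near=> x; rewrite /F /i2 /= (ld_G ld) //.
    by near: x.
  rewrite deriveE; last exact: (differentiable_comp di2 (dF Uz)).
  rewrite (diff_comp di2 (dF Uz)) /= (diff_pair dc1 did) /=.
  by rewrite diff_cst diff_val.
pose i1 := (fun w : 'rV[C]_nu => (w, z)).
have di1 : differentiable i1 c1 by exact: differentiable_pair.
have dG := differentiable_slice Uz.
transitivity ('d (G^~ z) c1 u).
  rewrite (_ : G^~ _ = F \o i1) // (diff_comp di1 (dF Uz)) /= diff_pair //=.
  by rewrite diff_cst diff_val.
by rewrite linear_row; apply: eq_bigr => k _; rewrite /partial deriveE.
Unshelve. all: by end_near. Qed.

(** The next iterate is w |-> G(w, f(w)); the chain rule for it is the recursion of [variation] at t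
    = 1. *)
Lemma diff_iter_deformation j n :
  (forall i, (0 < i <= n)%N -> U (iter i g (c0 0 j))) ->
  let f w := iter n (G w) (w 0 j) in
  [/\ f c1 = iter n.+1 g (c0 0 j), differentiable f c1 &
    forall u, 'd f c1 u = variation g g^`()%classic
      (fun x k => partial (G^~ x) k c1) c0 1 u j n].
Proof.
elim: n => [_|n IHn Ug] /=.
  have dj : differentiable (fun w : 'rV[C]_nu => w 0 j) c1.
    exact: differentiable_coord.
  by split=> [||u] //; [rewrite mxE | exact: diff_coord].
have [i|fn df Df] := IHn.
  by move=> /andP[i0 /leqW il]; apply: Ug; rewrite i0.
set f := fun w : 'rV[C]_nu => iter n (G w) (w 0 j).
have Un : U (f c1) by rewrite /f fn; apply: Ug; rewrite /= leqnn.
pose i1 := fun w : 'rV[C]_nu => (w, f w).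
have did : differentiable (id : 'rV[C]_nu -> 'rV[C]_nu) c1.
  exact: (@ex_diff _ _ _ _ _ _ _ (is_diff_id _)).
have di1 : differentiable i1 c1 := differentiable_pair did df.
rewrite -[fun w => G w _]/(F \o i1); split.
- by rewrite fn (ld_G ld) // -fn.
- exact: (differentiable_comp di1 (dF Un)).
- move=> u; transitivity ('d F (c1, f c1) (u, 'd f c1 u)).
    have di1u : 'd i1 c1 u = (u, 'd f c1 u).
      transitivity ('d (id : 'rV[C]_nu -> 'rV[C]_nu) c1 u, 'd f c1 u).
        exact: (congr1 (fun k : 'rV[C]_nu -> 'rV[C]_nu * C => k u)
          (diff_pair did df)).
      by rewrite diff_val.
    rewrite -di1u.
    exact: (congr1 (fun k : 'rV[C]_nu -> C => k u) (diff_comp di1 (dF Un))).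
  apply: (etrans (diff_deformation u ('d f c1 u) Un)).
  by rewrite Df (fn : f c1 = _) invr1 mul1r.
Qed.

Lemma jacobian_relation (r : nat) (q l : 'I_nu -> nat) (mu : 'I_nu -> 'I_nu) :
  (forall j : 'I_nu, (j < r)%N -> returns g c0 (q j) (mu j) j) ->
  (forall j : 'I_nu, (r <= j)%N -> eventually_periodic g c0 (q j) (l j) j) ->
  'J (relation_map G p r q l mu) c1 = \matrix_(k, j) relation_variation g
    g^`()%classic (fun x k => partial (G^~ x) k c1)
    (fun j k => partial (fun w => p w 0 j) k c1) c0 r q l mu 1
    (delta_mx 0 k) j.
Proof.
move=> rel_a rel_b.
have Uorb j n : (n < q j)%N ->
    forall i, (0 < i <= n)%N -> U (iter i g (c0 0 j)).
  move=> nq i /andP[i0 i_n]; apply: (mm_PU mm).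
    elim: {i0 i_n} i => [|i IHi] /=; last exact: mm_stable mm _ IHi.
    by apply: (mm_P0 mm); apply/imfsetP; exists j.
  by apply: (first_return_notin rel_a rel_b); rewrite i0 (leq_ltn_trans i_n).
have q0 := period_gt0 rel_a rel_b.
have dp i : differentiable (fun w => p w 0 i) c1.
  apply: (differentiable_comp (g := fun v : 'rV[C]_nu => v 0 i)).
    by apply: (ld_p_holo ld); exact: ld_W ld.
  exact: differentiable_coord.
pose Rj j w := relation_map G p r q l mu w 0 j.
have RjE j : differentiable (Rj j) c1 /\ forall u, 'd (Rj j) c1 u =
    relation_variation g g^`()%classic (fun x k => partial (G^~ x) k c1)
    (fun j k => partial (fun w => p w 0 j) k c1) c0 r q l mu 1 u j.
  have [|_ dq Dq] := @diff_iter_deformation j (q j).-1.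
    by apply: Uorb; rewrite prednK.
  rewrite /relation_variation; case: ltnP => jr.
    have -> : Rj j = (fun w => iter (q j).-1 (G w) (w 0 j)) -
        (fun w => p w 0 (mu j)).
      by apply/funext => w; rewrite /Rj mxE jr.
    split=> [|u]; first exact: differentiableB.
    rewrite diffB // -Dq mul1r /=; congr (_ - _).
    by rewrite linear_row; apply: eq_bigr => k _; rewrite /partial deriveE.
  have [/andP[l0 lq] _ _] := rel_b j jr.
  have [|_ dl Dl] := @diff_iter_deformation j (l j).-1.
    by apply: Uorb; rewrite prednK // ltnW.
  have -> : Rj j = (fun w => iter (q j).-1 (G w) (w 0 j)) -
      (fun w => iter (l j).-1 (G w) (w 0 j)).
    by apply/funext => w; rewrite /Rj mxE ltnNge jr.
  split=> [|u]; first exact: differentiableB.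
  by rewrite diffB // -Dq -Dl.
(* Splitting the map into coordinates yields its differentiability from that of each R_j. *)
pose e j w := Rj j w *: (delta_mx 0 j : 'rV[C]_nu).
have RE : relation_map G p r q l mu = \sum_j e j.
  apply/funext => w; rewrite fct_sumE [LHS]row_sum_delta.
  by apply: eq_bigr.
have de j : differentiable (e j) c1.
  by have [dR _] := RjE j; exact: differentiableZl.
have dR : differentiable (relation_map G p r q l mu) c1.
  by rewrite RE; exact: differentiable_sum.
apply/matrixP => k j; rewrite [RHS]mxE.
have -> : 'J (relation_map G p r q l mu) c1 k j =
    'd (relation_map G p r q l mu) c1 (delta_mx 0 k) 0 j.
  by rewrite /jacobian mxE.
have [dRj <-] := RjE j.
have dj : differentiable (fun v : 'rV[C]_nu => v 0 j)
    (relation_map G p r q l mu c1) by exact: differentiable_coord.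
rewrite -[Rj j]/((fun v : 'rV[C]_nu => v 0 j) \o relation_map G p r q l mu).
by rewrite (diff_comp dR dj) /= diff_coord.
Qed.

End Deformation.

Lemma cvg_line (C : numFieldType) (V : normedModType C) (a v : V) :
  (fun h : C => h *: v + a) @ (0 : C) --> a.
Proof.
have cvg_scale : (fun h : C => h *: v) @ (0 : C) --> 0 *: v.
  exact: scalel_continuous.
have cvg_a : (fun _ : C => a) @ (0 : C) --> a.
  exact: (@cst_continuous C V a 0).
by have := cvgD cvg_scale cvg_a; rewrite scale0r add0r; apply.
Qed.

(** * Real symmetry makes all the derivatives involved real *)

Section RealDeformation.
Context {R : realType} {nu : nat}.
Local Notation C := (Cplx R).
Context (g : C -> C) (c0 : 'rV[C]_nu) (U : set C) (P : {fset C}).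
Context (W : set 'rV[C]_nu) (G : 'rV[C]_nu -> C -> C).
Context (p : 'rV[C]_nu -> 'rV[C]_nu).
Context (mm : marked_map g c0 U P) (rmm : real_marked_map g U P)
  (ld : local_deformation g c0 U W G p) (rd : real_deformation U W G p).

Let c1 := crit_value g c0.

Lemma orbit_in n j : iter n g (c0 0 j) \in P.
Proof.
elim: n => [|n IHn] /=; last exact: mm_stable mm _ IHn.
by apply: (mm_P0 mm); apply/imfsetP; exists j.
Qed.

Let c1_real k : c1 0 k \is Num.real.
Proof. by rewrite mxE (rmm_P rmm) // (orbit_in 1). Qed.

Let shift_real (h : C) k : h \is Num.real ->
  map_mx Num.conj (h *: delta_mx 0 k + c1) = h *: delta_mx 0 k + c1.
Proof.
move=> hR; apply/rowP => i; rewrite !mxE; apply/eqP; rewrite -CrealE.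
have := c1_real i; rewrite mxE => c1R.
by rewrite rpredD // rpredM // realn.
Qed.

Let W_near k : \forall h \near (0 : C), W (h *: delta_mx 0 k + c1).
Proof.
apply: (@cvg_line _ _ c1); apply: open_nbhs_nbhs.
by split; [exact: ld_open ld | exact: ld_W ld].
Qed.

Lemma deriv_real x : U x -> x \is Num.real -> g^`()%classic x \is Num.real.
Proof.
move=> Ux xR; rewrite derive1E; apply: derive_real.
  by apply: diff_derivable; exact: (mm_holo mm).
have nU : \forall y \near x, U y.
  by apply: open_nbhs_nbhs; split => //; exact: mm_open mm.
have nU0 := cvg_line (1 : C) nU.
near=> h => hR; have Uh : U (h *: (1 : C) + x) by near: h.
rewrite CrealE -(rmm_g rmm) // conj_Creal //.
by rewrite rpredD // rpredM // rpred1.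
Unshelve. all: by end_near. Qed.

Lemma partial_G_real x k : U x -> x \is Num.real ->
  partial (G^~ x) k c1 \is Num.real.
Proof.
move=> Ux xR; apply: derive_real.
  by apply: diff_derivable; exact: (differentiable_slice ld Ux).
have nW := W_near k.
near=> h => hR; have Wh : W (h *: delta_mx 0 k + c1) by near: h.
by rewrite CrealE -(rd_G rd) // shift_real // conj_Creal.
Unshelve. all: by end_near. Qed.

Lemma partial_p_real j k : partial (fun w => p w 0 j) k c1 \is Num.real.
Proof.
apply: derive_real.
  apply: diff_derivable.
  apply: (differentiable_comp (g := fun v : 'rV[C]_nu => v 0 j)).
    by apply: (ld_p_holo ld); exact: ld_W ld.
  exact: differentiable_coord.
have nW := W_near k.
near=> h => hR; have Wh : W (h *: delta_mx 0 k + c1) by near: h.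
by rewrite CrealE -{2}(shift_real k hR) (rd_p rd) // mxE.
Unshelve. all: by end_near. Qed.

End RealDeformation.

(** * The transversality inequality *)

Theorem corollary4p3 (R : realType) (nu : nat) (nu_gt0 : (0 < nu)%N)
    (g : Cplx R -> Cplx R) (c0 : 'rV[Cplx R]_nu) (U : set (Cplx R))
    (P : {fset Cplx R})
    (W : set 'rV[Cplx R]_nu) (G : 'rV[Cplx R]_nu -> Cplx R -> Cplx R)
    (p : 'rV[Cplx R]_nu -> 'rV[Cplx R]_nu)
    (r : nat) (q l : 'I_nu -> nat) (mu : 'I_nu -> 'I_nu)
    (g_marked : marked_map g c0 U P)
    (g_real : real_marked_map g U P)
    (G_deform : local_deformation g c0 U W G p)
    (G_real : real_deformation U W G p)
    (r_le : (r <= nu)%N)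
    (rel_a : forall j : 'I_nu, (j < r)%N -> returns g c0 (q j) (mu j) j)
    (rel_b : forall j : 'I_nu, (r <= j)%N ->
      eventually_periodic g c0 (q j) (l j) j)
    (expanding : forall j : 'I_nu, (r <= j)%N ->
      1 < `|(iter (q j - l j) g)^`()%classic (iter (l j) g (c0 0 j))|)
    (spectrum : forall rho : Cplx R,
      passmx.leigenvalue (transfer_operator g c0 P G p) rho ->
      `|rho| <= 1 /\ rho != 1) :
  let c1 := crit_value g c0 in
  0 < \det ('J (relation_map G p r q l mu) c1)
      / \prod_(j < nu) (iter (q j).-1 g)^`()%classic (c1 0 j).
Proof.
cbv zeta; set c1 := crit_value g c0.
pose dg : Cplx R -> Cplx R := g^`()%classic.
pose dG := fun x k => partial (G^~ x) k c1.
pose dp := fun j k => partial (fun w => p w 0 j) k c1.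
have orbP := orbit_in g_marked.
have orbU j n : iter n g (c0 0 j) \notin marked_pts c0 -> U (iter n g (c0 0 j)).
  exact: (mm_PU g_marked).
have dg0 j n : (0 < n)%N -> iter n g (c0 0 j) \notin marked_pts c0 ->
    dg (iter n g (c0 0 j)) != 0.
  by move=> _; exact: (mm_deriv g_marked).
have q0 := period_gt0 rel_a rel_b.
have notinP0 := first_return_notin rel_a rel_b.
have mult0 := multiplier_neq0 rel_a rel_b dg0.
have multE j : (iter (q j).-1 g)^`()%classic (c1 0 j) =
    multiplier g dg (g (c0 0 j)) (q j).-1.
  rewrite mxE; have [//|_ ->//] := derive1_iter (n := (q j).-1)
    (x := g (c0 0 j)) (mm_holo g_marked).
  move=> i iq; rewrite -iterSr; apply: orbU; apply: notinP0.
  by rewrite /= -ltn_predRL.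
have expanding' (j : 'I_nu) : (r <= j)%N ->
    1 < `|multiplier g dg (iter (l j) g (c0 0 j)) (q j - l j)|.
  move=> jr; have [/andP[l0 lq] _ notin_b] := rel_b j jr.
  have [|_ <-] := derive1_iter (n := (q j - l j)%N) (x := iter (l j) g (c0 0 j))
    (mm_holo g_marked); last exact: expanding.
  move=> i iq; rewrite -iterD; apply: orbU; apply: notin_b; lia.
pose D := relation_poly g dg dG dp c0 r q l mu.
(* Row j of D(1) is the gradient of R_j divided by Dg^(q_j - 1)(c_{1,j}), so the quotient of the
   statement is det D(1). *)
have JE : 'J (relation_map G p r q l mu) c1 =
    (diag_mx (\row_j multiplier g dg (g (c0 0 j)) (q j).-1) *m
      map_mx (horner_eval 1) D)^T.
  rewrite (jacobian_relation g_marked G_deform rel_a rel_b).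
  apply/matrixP => k j; rewrite [LHS]mxE [RHS]mxE mul_diag_mx [RHS]mxE.
  rewrite [X in _ = X * _]mxE [X in _ = _ * X]mxE.
  (* Evaluating at t = 1 on the k-th basis vector extracts the entry (j, k). *)
  have := relation_polyE dG dp rel_a rel_b dg0 (delta_mx 0 k) j (oner_neq0 _).
  rewrite (bigD1 k) //= big1 ?addr0 => [|i ik]; last first.
    by rewrite [delta_mx _ _ _ _]mxE eqxx (negbTE ik) mulr0.
  rewrite [delta_mx _ _ _ _]mxE !eqxx mulr1 expr1n mul1r /horner_eval -/D => ->.
  by rewrite mulVKf // mult0 // prednK.
rewrite (eq_bigr _ (fun j _ => multE j)) JE det_tr det_mulmx det_diag.
rewrite [X in X * _ / _](eq_bigr
  (fun j => multiplier g dg (g (c0 0 j)) (q j).-1)); last first.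
  by move=> j _; rewrite mxE.
rewrite mulrC mulKf; last first.
  by rewrite prodf_seq_neq0; apply/allP => j _; rewrite mult0 // prednK.
rewrite det_map_mx /horner_eval; apply: real_poly_gt0.
- have dGR j n : iter n g (c0 0 j) \notin marked_pts c0 ->
      (forall k, dG (iter n g (c0 0 j)) k \is Num.real) /\
      dg (iter n g (c0 0 j)) \is Num.real.
    move=> /orbU Ux; have xR := rmm_P g_real (orbP n j).
    split=> [k|]; last exact: (deriv_real g_marked g_real Ux xR).
    exact: (partial_G_real g_marked g_real G_deform G_real k Ux xR).
  move=> i; apply: (det_relation_poly_closed rel_a rel_b) => [j n _|j k].
    exact: dGR.
  exact: (partial_p_real g_marked g_real G_deform G_real).
- by rewrite -[_.[0]]/(horner_eval 0 _) -det_map_mx relation_poly0 ?det1.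
- move=> t t01; apply/negP; rewrite /root -[_.[t]]/(horner_eval t _).
  (* [det0P] yields a row vector killed from the left, so the transpose is taken to get D(t) w =
     0. *)
  rewrite -det_map_mx -det_tr => /det0P[w w0 Dw].
  have /andP[t_gt0 t1] := t01; have t0 : t != 0 by rewrite gt_eqF.
  have rel0 j : relation_variation g dg dG dp c0 r q l mu t w j = 0.
    have /eqP := relation_polyE dG dp rel_a rel_b dg0 w j t0.
    have := congr1 (fun u : 'rV_nu => u 0 j) Dw; rewrite !mxE => Dwj.
    rewrite (_ : \sum_k _ = 0); last first.
      by rewrite -[RHS]Dwj; apply: eq_bigr => k _; rewrite !mxE mulrC.
    (* The scaling factor of row j is nonzero, so the relation itself vanishes on w. *)
    rewrite eq_sym !mulf_eq0 expf_eq0 (negbTE t0) andbF invr_eq0.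
    by rewrite (negbTE (mult0 _ _ _)) ?prednK //= => /eqP.
  have [S [V [SV1 Sorb SV0 SVn]]] := orbit_eigenfunction
    (mm_inj g_marked) rel_a rel_b dg0 t01 rel0 expanding'.
  have [] : `|t^-1| <= 1 /\ t^-1 != 1.
    apply: spectrum.
    apply: (leigenvalue_transfer_operator (S := S) (V := V) g_marked).
    + by rewrite invr_eq0.
    + by move=> k; rewrite mxE; have [] := SV1 k.
    + have /rV0Pn[k wk] := w0; exists k.
      by rewrite mxE; have [_ ->] := SV1 k.
    + by move=> x /Sorb[j [n ->]]; apply/imfsetP; exists (iter n g (c0 0 j)).
    + move=> i /SV0 ->; rewrite mulKf //.
      by apply: eq_bigr => k _; rewrite mxE; have [_ ->] := SV1 k.
    + move=> x Sx xP0; have [Sgx Vgx] := SVn _ Sx xP0; split=> //.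
      rewrite Vgx; congr (_ + _); apply: eq_bigr => k _.
      by rewrite mxE; have [_ ->] := SV1 k.
  (* The modulus bound gives t >= 1, hence t = 1, but the eigenvalue 1 is excluded. *)
  rewrite gtr0_norm ?invr_gt0 // invf_le1 // invr_eq1 => t1'.
  by rewrite eq_le t1' t1.
Qed.
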